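(* Let $(G,\sigma)$ be a signed graph and let $r=\frac{p}{q}$ where $p,q$ are positive integers, $p$ is even and $p\ge 2q$. The following are equivalent: (1) $(G,\sigma)$ admits a circular $r$-flow; (2) $(G,\sigma)$ admits a $(p,q)$-flow; (3) $(G,\sigma)$ admits a modulo $(p,q)$-flow; (4) $(G,\sigma)$ admits a circular modulo $r$-flow.
   Context: Graphs are finite, may have multiple edges but no loops; a signed graph $(G,\sigma)$ has $\sigma:E(G)\to\{+,-\}$. For an orientation $D$ of $G$ and $f:E(G)\to\mathbb{R}$ (or $\mathbb{Z}$, or $\mathbb{Z}_p$), let $\partial_D f(v)=\sum_{e\text{ out-arc at }v}f(e)-\sum_{e\text{ in-arc at }v}f(e)$. A circular $r$-flow ($r\ge2$ real) is a pair $(D,f)$ with $D$ an orientation of $G$ and $f:E(G)\to(-r,r)$ such that $|f(e)|\in[1,r-1]$ for each positive edge, $|f(e)|\in[0,\frac r2-1]\cup[\frac r2+1,r)$ for each negative edge, and $\partial_Df(v)=0$ for every vertex $v$. For $p$ even and $q\le p/2$, a $(p,q)$-flow is a pair $(D,f)$ with $f:E(G)\to\mathbb{Z}$ such that $f(e)\in\{q,\dots,p-q\}$ for each positive edge, $f(e)\in\{0,\dots,\frac p2-q\}\cup\{\frac p2+q,\dots,p-1\}$ for each negative edge, and $\partial_Df(v)=0$ for all $v$. A modulo $(p,q)$-flow is the same but with $f:E(G)\to\mathbb{Z}_p$ (same allowed values) and $\partial_Df(v)\equiv0\pmod p$ for all $v$. A circular modulo $r$-flow is a pair $(D,f)$ with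 $f:E(G)\to[0,r)$ such that $f(e)\in[1,r-1]$ for positive edges, $f(e)\in[0,\frac r2-1]\cup[\frac r2+1,r)$ for negative edges, and $\partial_Df(v)\equiv0\pmod r$ for all $v$. *)

(* Defs.v *)
From HB Require Import structures.
From mathcomp Require Import all_boot all_order all_algebra.
From mathcomp Require Import reals.
Set Implicit Arguments.
Unset Strict Implicit.
Unset Printing Implicit Defensive.
Import Order.TTheory GRing.Theory Num.Theory.
Local Open Scope ring_scope.

Inductive sign := Pos | Neg.

(* [edge] is a separate type, so parallel edges are allowed; the cardinality  *)
(* condition excludes loops.                                                  *)
Record signed_graph := SignedGraph {
  vertex : finType;
  edge : finType;
  ends : edge -> {set vertex};
  card_ends : forall e, #|ends e| = 2%N;
  sigma : edge -> sign
}.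

Record orientation (G : signed_graph) := Orientation {
  tail : edge G -> vertex G;
  head : edge G -> vertex G;
  ends_orientation : forall e, ends e = [set tail e; head e]
}.

Definition boundary (A : zmodType) (G : signed_graph) (D : orientation G)
    (f : edge G -> A) (v : vertex G) : A :=
  \sum_(e | tail D e == v) f e - \sum_(e | head D e == v) f e.

Definition circular_flow (R : realType) (r : R) (G : signed_graph)
    (D : orientation G) (f : edge G -> R) : Prop :=
  [/\ forall e, - r < f e < r,
      forall e, match sigma e with
        | Pos => 1 <= `|f e| <= r - 1
        | Neg => (0 <= `|f e| <= r / 2 - 1) || (r / 2 + 1 <= `|f e| < r)
        end
    & forall v, boundary D f v = 0].

Definition circular_modulo_flow (R : realType) (r : R) (G : signed_graph)
    (D : orientation G) (f : edge G -> R) : Prop :=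
  [/\ forall e, 0 <= f e < r,
      forall e, match sigma e with
        | Pos => 1 <= f e <= r - 1
        | Neg => (0 <= f e <= r / 2 - 1) || (r / 2 + 1 <= f e < r)
        end
    & forall v, exists k : int, boundary D f v = k%:~R * r].

(* Meant for even p, so that p./2 is exactly p/2. *)
Definition pq_value (p q : nat) (s : sign) (x : int) : bool :=
  match s with
  | Pos => q%:Z <= x <= p%:Z - q%:Z
  | Neg => (0 <= x <= p./2%:Z - q%:Z)
           || (p./2%:Z + q%:Z <= x <= p%:Z - 1)
  end.

Definition pq_flow (p q : nat) (G : signed_graph)
    (D : orientation G) (f : edge G -> int) : Prop :=
  (forall e, pq_value p q (sigma e) (f e)) /\
  (forall v, boundary D f v = 0).

(* Values in 'Z_p are compared through their representative in {0,..,p-1};    *)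
(* 'Z_p is the ring of integers mod p only when 1 < p.                        *)
Definition modulo_pq_flow (p q : nat) (G : signed_graph)
    (D : orientation G) (f : edge G -> 'Z_p) : Prop :=
  (forall e, pq_value p q (sigma e) (nat_of_ord (f e))%:Z) /\
  (forall v, boundary D f v = 0).

Definition admits_circular_flow (R : realType) (r : R) (G : signed_graph) :=
  exists (D : orientation G) (f : edge G -> R), circular_flow r D f.

Definition admits_pq_flow (p q : nat) (G : signed_graph) :=
  exists (D : orientation G) (f : edge G -> int), pq_flow p q D f.

Definition admits_modulo_pq_flow (p q : nat) (G : signed_graph) :=
  exists (D : orientation G) (f : edge G -> 'Z_p), @modulo_pq_flow p q G D f.

Definition admits_circular_modulo_flow (R : realType) (r : R)
    (G : signed_graph) :=
  exists (D : orientation G) (f : edge G -> R), circular_modulo_flow r D f.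

(* Main.v *)
Require Import Defs.
From mathcomp Require Import all_boot all_order all_algebra.
From mathcomp Require Import reals.
From mathcomp Require Import zify lra.
Set Implicit Arguments.
Unset Strict Implicit.
Unset Printing Implicit Defensive.
Import Order.TTheory GRing.Theory Num.Theory.
Local Open Scope ring_scope.

(** The engine is integral rounding: a real function on the edges with
    integral boundary can be rounded, edge by edge up or down, to an integral
    function with the same boundary.  Indeed no vertex meets exactly one
    non-integral edge, so if there are non-integral edges, they carry a nonzero
    circulation by a dimension count; moving along it makes one more edge
    integral.

    Rounding [q |f|] turns a circular flow into a modulo [(p,q)]-flow.  Rounding
    [f / r] (resp. [f / p]) turns a modulo flow into a genuine one: subtract [r]
    where it is rounded up, and reverse those edges.  The allowed sets of values
    are symmetric under [x |-> r - x] for [x <> 0], and a zero value is never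
    rounded up. *)

(** * Linear dependence over a field *)

(** A matrix with more rows than columns has a nonzero left kernel; a kernel vector is extended by
    zero outside [A]. *)
Lemma exists_linear_relation (F : fieldType) (I J : finType) (A : {set I})
    (B : {set J}) (c : I -> J -> F) : (#|B| < #|A|)%N ->
  exists z : I -> F, [/\ forall i, i \notin A -> z i = 0,
    exists i, z i != 0 & forall j, j \in B -> \sum_i z i * c i j = 0].
Proof.
move=> ltBA.
pose M := \matrix_(i < #|A|, j < #|B|) c (enum_val i) (enum_val j).
have: kermx M != 0.
  rewrite kermx_eq0 -row_leq_rank -ltnNge.
  exact: leq_ltn_trans (rank_leq_col _) ltBA.
case/rowV0Pn=> u /sub_kermxP uM0 /eqP u_neq0.
have [i0 ui0] : exists i, u 0 i != 0.
  apply/existsP; apply: contra_notT u_neq0 => /existsPn u0.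
  by apply/rowP => i; rewrite mxE; have /negPn/eqP := u0 i.
have Ai0 := enum_valP i0.
pose z i := if i \in A then u 0 (enum_rank_in Ai0 i) else 0.
have zE k : z (enum_val k) = u 0 k by rewrite /z enum_valP enum_valK_in.
exists z; split=> [i /negPf Ai | | j Bj]; first by rewrite /z Ai.
  by exists (enum_val i0); rewrite zE.
have /rowP/(_ (enum_rank_in Bj j)) := uM0; rewrite !mxE => sum0.
rewrite -(big_rmcond (fun i => i \in A)) => [|i /negPf Ai]; last first.
  by rewrite /z Ai mul0r.
rewrite big_enum_val -[RHS]sum0.
by apply: eq_bigr => k _; rewrite zE mxE enum_rankK_in.
Qed.

(** * Algebra of the boundary operator *)

Lemma boundaryE (A : zmodType) (G : signed_graph) (D : orientation G)
    (f : edge G -> A) v :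
  boundary D f v = \sum_e (f e *+ (tail D e == v) - f e *+ (Defs.head D e == v)).
Proof.
rewrite /boundary big_mkcond [X in _ - X]big_mkcond -sumrB /=.
by apply: eq_bigr => e _; do 2 case: eqP.
Qed.

Lemma boundaryEr (R : pzRingType) (G : signed_graph) (D : orientation G)
    (f : edge G -> R) v :
  boundary D f v = \sum_e f e * ((tail D e == v)%:R - (Defs.head D e == v)%:R).
Proof.
by rewrite boundaryE; apply: eq_bigr => e _; rewrite mulrBr !mulr_natr.
Qed.

Lemma boundary_intr (R : pzRingType) (G : signed_graph) (D : orientation G)
    (f : edge G -> int) v :
  boundary D (fun e => (f e)%:~R : R) v = (boundary D f v)%:~R.
Proof. by rewrite /boundary rmorphB !rmorph_sum. Qed.

Lemma eq_boundary (A : zmodType) (G : signed_graph) (D : orientation G)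
    (f g : edge G -> A) : f =1 g -> boundary D f =1 boundary D g.
Proof. by move=> fg v; congr (_ - _); apply: eq_bigr. Qed.

Lemma boundaryD (A : zmodType) (G : signed_graph) (D : orientation G)
    (f g : edge G -> A) v :
  boundary D (fun e => f e + g e) v = boundary D f v + boundary D g v.
Proof. by rewrite /boundary !big_split opprD addrACA. Qed.

Lemma boundaryZ (R : pzRingType) (G : signed_graph) (D : orientation G)
    (f : edge G -> R) c v :
  boundary D (fun e => c * f e) v = c * boundary D f v.
Proof. by rewrite /boundary mulrBr !mulr_sumr. Qed.

Lemma sum_boundary (A : zmodType) (G : signed_graph) (D : orientation G)
    (f : edge G -> A) : \sum_v boundary D f v = 0.
Proof.
have sumE (h : edge G -> vertex G) : \sum_v \sum_(e | h e == v) f e = \sum_e f e.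
  by rewrite (partition_big h predT).
by rewrite /boundary sumrB !sumE subrr.
Qed.

(** * Circulations supported on a given edge set *)

(** Edge ends are counted, so the handshake identity holds without looking at how the ends of an
    edge are placed. *)
Definition degree (G : signed_graph) (D : orientation G) (S : {set edge G}) v :=
  (\sum_(e in S) ((tail D e == v) + (Defs.head D e == v)))%N.

Lemma sum_degree (G : signed_graph) (D : orientation G) (S : {set edge G}) :
  (\sum_v degree D S v = #|S| * 2)%N.
Proof.
rewrite exchange_big -sum_nat_const; apply: eq_bigr => e _.
have sum1 x : (\sum_(v : vertex G) (x == v) = 1)%N.
  by rewrite (bigD1 x) //= eqxx big1 // => v /negPf; rewrite eq_sym => ->.
by rewrite big_split /= !sum1.
Qed.

(* The degree condition gives at least as many edges in [S] as vertices met   *)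
(* by [S], and the equations [boundary z v = 0] at these vertices are         *)
(* linearly dependent, so one of them can be dropped.                         *)
Lemma exists_circulation (F : fieldType) (G : signed_graph) (D : orientation G)
    (S : {set edge G}) :
  S != set0 -> (forall v, degree D S v != 1%N) ->
  exists z : edge G -> F, [/\ forall e, e \notin S -> z e = 0,
    exists e, z e != 0 & forall v, boundary D z v = 0].
Proof.
case/set0Pn=> e0 Se0 deg_neq1.
pose W := [set v | degree D S v != 0%N].
have Wt : tail D e0 \in W by rewrite inE /degree (bigD1 e0) //= eqxx.
have leWS : (#|W| <= #|S|)%N.
  rewrite -(leq_pmul2r (isT : 0 < 2)%N) -(sum_degree D) -sum_nat_const.
  rewrite big_mkcond leq_sum //= => v _; rewrite inE.
  by move: (deg_neq1 v); case: (degree D S v) => [|[]].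
have ltWS : (#|W :\ tail D e0| < #|S|)%N.
  by move: leWS; rewrite (cardsD1 (tail D e0) W) Wt.
have [z [zS z_neq0 zW]] := exists_linear_relation
  (fun e v => (tail D e == v)%:R - (Defs.head D e == v)%:R : F) ltWS.
have bd0 v : v != tail D e0 -> boundary D z v = 0.
  move=> v_neq; have [Wv | ] := boolP (v \in W).
    by rewrite boundaryEr zW // in_setD1 v_neq.
  rewrite inE negbK sum_nat_eq0 => /forall_inP degv.
  rewrite boundaryE big1 // => e _.
  have [/degv | /zS ->] := boolP (e \in S); last by rewrite !mul0rn subrr.
  by rewrite addn_eq0 !eqb0 => /andP[/negPf-> /negPf->]; rewrite subrr.
exists z; split=> // v; have [-> | /bd0 //] := eqVneq v (tail D e0).
by rewrite -(sum_boundary D z) (bigD1 (tail D e0)) //= [X in _ + X]big1 ?addr0.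
Qed.

(** * Integral rounding *)

(** With a single non-integral edge at [v], the boundary at [v] would be plus or minus its value up
    to an integer, hence non-integral. *)
Lemma degree_nonint_neq1 (R : archiRealFieldType) (G : signed_graph)
    (D : orientation G) (f : edge G -> R) v :
  boundary D f v \is a Num.int ->
  degree D [set e | f e \isn't a Num.int] v != 1%N.
Proof.
set S := [set e | _] => bd_int; apply/negP => /eqP deg1.
have /sum_nat_eq1[e0 [Se0 a1 a0]] : degree D S v == 1%N by apply/eqP.
have rest : \sum_(e | e != e0)
    (f e *+ (tail D e == v) - f e *+ (Defs.head D e == v)) \is a Num.int.
  apply: rpred_sum => e e_neq; have [Se | ] := boolP (e \in S).
    have /eqP := a0 e e_neq Se; rewrite addn_eq0 => /andP[/eqP-> /eqP->].
    by rewrite subrr rpred0.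
  by rewrite inE negbK => fe; rewrite rpredB ?rpredMn.
move: bd_int; rewrite boundaryE (bigD1 e0) //= rpredDr // => f0.
suff : f e0 \is a Num.int by move: Se0; rewrite inE => /negPf->.
by move: a1 f0; do 2 case: eqP => //= _; rewrite ?subr0 ?sub0r ?rpredN.
Qed.

Lemma exists_rounding_step (R : archiRealFieldType) (G : signed_graph)
    (D : orientation G) (f : edge G -> R) :
  (forall v, boundary D f v \is a Num.int) ->
  [set e | f e \isn't a Num.int] != set0 ->
  exists g : edge G -> R,
    [/\ forall v, boundary D g v = boundary D f v,
        forall e, (Num.floor (f e))%:~R <= g e <= (Num.ceil (f e))%:~R &
        [set e | g e \isn't a Num.int] \proper [set e | f e \isn't a Num.int]].
Proof.
move=> bd_int S_neq0.
have [z [zS [e0 ze0] bdz]] := exists_circulation R S_neq0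
  (fun v => degree_nonint_neq1 (bd_int v)).
(* The time at which [e] becomes integral when [f] moves in the direction [z]: upwards to the
   ceiling if [z e > 0], downwards to the floor if [z e < 0]. *)
pose t e := ((if 0 < z e then (Num.ceil (f e))%:~R else (Num.floor (f e))%:~R)
             - f e) / z e.
have tz e : z e != 0 -> f e + t e * z e =
    if 0 < z e then (Num.ceil (f e))%:~R else (Num.floor (f e))%:~R.
  by move=> ze; rewrite /t divfK // addrC subrK.
have fl e := floor_le (f e); have ce e := ceil_ge (f e).
have t_ge0 e : 0 <= t e.
  rewrite /t; case: (ltP 0 (z e)) => [z_gt0 | z_le0].
    by rewrite divr_ge0 ?subr_ge0 // ltW.
  by rewrite -mulrNN -invrN divr_ge0 ?oppr_ge0 ?subr_le0.
(* Stopping at the earliest such time keeps every edge between its floor and ceiling, and makes [e1]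
   integral. Edges already integral do not move, since [z] vanishes on them. *)
case: (@arg_minP _ _ _ e0 (fun e => z e != 0) t ze0) => e1 ze1 t_min.
exists (fun e => f e + t e1 * z e); split=> [v | e |].
- by rewrite boundaryD boundaryZ bdz mulr0 addr0.
- have [-> | ze] := eqVneq (z e) 0; first by rewrite mulr0 addr0 fl ce.
  have := tz e ze; have := t_min e ze; have := t_ge0 e1.
  have := fl e; have := ce e.
  case: (ltP 0 (z e)) => z0 ? ? ? ? <-; apply/andP; nra.
- apply/properP; split.
    apply/subsetP => e; rewrite !inE; apply: contra => fe.
    by rewrite zS ?mulr0 ?addr0 // inE fe.
  exists e1; first by apply: contraR ze1 => /zS ->.
  by rewrite inE negbK tz //; case: ifP => _; apply: intr_int.
Qed.

(** Induction on the number of non-integral edges. The floor and ceiling of [f e] are integers, so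
    they still bound those of any intermediate value. *)
Lemma exists_integral_rounding (R : archiRealFieldType) (G : signed_graph)
    (D : orientation G) (f : edge G -> R) :
  (forall v, boundary D f v \is a Num.int) ->
  exists g : edge G -> int,
    (forall e, Num.floor (f e) <= g e <= Num.ceil (f e)) /\
    (forall v, (boundary D g v)%:~R = boundary D f v).
Proof.
have [n] := ubnP #|[set e | f e \isn't a Num.int]|.
elim: n => // n IHn in f * => /ltnSE le_n bd_int.
have [S0 | S_neq0] := eqVneq [set e | f e \isn't a Num.int] set0.
  have f_int e : f e \is a Num.int.
    by apply: contraT => fe; have := in_set0 e; rewrite -S0 inE fe.
  exists (fun e => Num.floor (f e)); split=> [e | v].
    by rewrite ceil_floor f_int addr0 lexx.
  by rewrite -boundary_intr; apply: eq_boundary => e /=; rewrite floorK.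
have [f' [bdf' f'_itv f'_lt]] := exists_rounding_step bd_int S_neq0.
have [|v|g [g_itv bdg]] := IHn f'; first exact: leq_trans (proper_card f'_lt) _.
  by rewrite bdf'.
exists g; split=> [e | v]; last by rewrite bdg bdf'.
have /andP[f'_ge f'_le] := f'_itv e; have /andP[g_ge g_le] := g_itv e.
rewrite (le_trans _ g_ge) ?floor_ge_int //=.
by rewrite (le_trans g_le) ?ceil_le_int.
Qed.

(** * Edge reversal, and removal of the modulus *)

Section Reversal.

Variables (G : signed_graph) (D : orientation G) (b : edge G -> bool).

Lemma ends_reversed e :
  ends e = [set if b e then Defs.head D e else tail D e;
                if b e then tail D e else Defs.head D e].
Proof. by rewrite (ends_orientation D); case: ifP => // _; rewrite setUC. Qed.

Definition reversed := Orientation ends_reversed.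

Lemma boundary_reversed (A : zmodType) (f : edge G -> A) v :
  boundary reversed (fun e => if b e then - f e else f e) v = boundary D f v.
Proof.
rewrite !boundaryE; apply: eq_bigr => e _ /=; case: (b e) => //.
by rewrite !mulNrn opprK addrC.
Qed.

End Reversal.

(** The rounding [g] of [f / r] takes values in {0, 1}, and [b] marks where it is 1. The conclusion
    [0 < f e] there is what the symmetry [x |-> r - x] of the allowed values requires. *)
Lemma exists_nonneg_flow (R : archiRealFieldType) (r : R) (G : signed_graph)
    (D : orientation G) (f : edge G -> R) :
  0 < r -> (forall e, 0 <= f e < r) ->
  (forall v, exists k : int, boundary D f v = k%:~R * r) ->
  exists (D' : orientation G) (b : edge G -> bool),
    (forall e, b e -> 0 < f e) /\
    (forall v, boundary D' (fun e => if b e then r - f e else f e) v = 0).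
Proof.
move=> r_gt0 f_itv bdf; have r_neq0 := lt0r_neq0 r_gt0.
have [v | g [g_itv bdg]] :=
    @exists_integral_rounding R G D (fun e => r^-1 * f e).
  by rewrite boundaryZ; have [k ->] := bdf v; rewrite mulrC mulfK // intr_int.
have gE e : g e = (g e == 1)%:R :> int /\ (g e == 1 -> 0 < f e).
  have /andP[f_ge0 f_ltr] := f_itv e; have /andP[] := g_itv e.
  have : 0 <= Num.floor (r^-1 * f e).
    by rewrite floor_ge0 mulr_ge0 // invr_ge0 ltW.
  have : Num.ceil (r^-1 * f e) <= 1.
    by rewrite ceil_le_int mulrC ler_pdivrMr // mul1r ltW.
  (* A zero value is not rounded up. *)
  have : f e <= 0 -> Num.ceil (r^-1 * f e) <= 0.
    by move=> f_le0; rewrite ceil_le0 pmulr_rle0 ?invr_gt0.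
  case: (ltP 0 (f e)) => [_ _ | _ /(_ isT)] ? ? ? ?; split=> //; lia.
exists (reversed D (fun e => g e == 1)), (fun e => g e == 1).
split=> [e | v]; first by case: (gE e).
(* On a marked edge the value is [f e - r], and reversal turns it into [r - f e]. The boundary
   vanishes because that of [g] is the boundary of [f] divided by [r]. *)
transitivity (boundary D (fun e => f e + - r * (g e)%:~R) v).
  rewrite -(boundary_reversed D (fun e => g e == 1)); apply: eq_boundary => e.
  rewrite {3 4}(proj1 (gE e)); case: eqP => _ /=.
    by rewrite mulr1 opprD opprK addrC.
  by rewrite mulr0 addr0.
rewrite boundaryD boundaryZ boundary_intr bdg boundaryZ.
by rewrite mulNr mulrA mulfV // mul1r subrr.
Qed.

(** * Integers modulo [p] and their representatives *)

Lemma val_Zp_int p n : (1 < p)%N ->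
  (nat_of_ord (n%:Z%:~R : 'Z_p))%:Z = (n %% p)%N.
Proof. by move=> p_gt1; rewrite val_Zp_nat. Qed.

Lemma dvdz_Zp p (k : int) : (1 < p)%N -> k%:~R = 0 :> 'Z_p -> (p%:Z %| k)%Z.
Proof.
move=> p_gt1 k0.
have {k0} : `|k|%N%:R = 0 :> 'Z_p.
  by case: k k0 => n //; rewrite NegzE abszN mulrNz => /eqP;
    rewrite oppr_eq0 => /eqP.
move/(congr1 (@nat_of_ord _)); rewrite val_Zp_nat //= => /eqP.
by rewrite -/(dvdn p _).
Qed.

Lemma lift_Zp_boundary p (G : signed_graph) (D : orientation G)
    (h : edge G -> 'Z_p) v : (1 < p)%N -> boundary D h v = 0 ->
  exists k : int, boundary D (fun e => (h e : nat)%:Z) v = k * p%:Z.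
Proof.
move=> p_gt1 bdh; apply/dvdzP/dvdz_Zp; rewrite // -boundary_intr.
by rewrite -[RHS]bdh; apply: eq_boundary => e; exact: natr_Zp.
Qed.

Lemma ltn_Zp p (x : 'Z_p) : (1 < p)%N -> (x < p)%N.
Proof. by move=> p_gt1; rewrite -[X in (_ < X)%N](Zp_cast p_gt1) ltn_ord. Qed.

(** * The implications between the four kinds of flow *)

Lemma circular_modulo_flow_circular (R : realType) (r : R) (G : signed_graph) :
  0 < r -> admits_circular_modulo_flow r G -> admits_circular_flow r G.
Proof.
move=> r_gt0 [D [f [f_itv f_val bdf]]].
have [D' [b [b_gt0 bdb]]] := exists_nonneg_flow r_gt0 f_itv bdf.
exists D', (fun e => if b e then r - f e else f e).
have norm_b e : `|if b e then r - f e else f e| = if b e then r - f e else f e.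
  by rewrite ger0_norm //; have := f_itv e; case: ifP; lra.
split=> // e; first by have := b_gt0 e; have := f_itv e; case: ifP => _; lra.
rewrite norm_b; have := f_val e; have := b_gt0 e; have := f_itv e.
case: (b e) => // /andP[f_ge0 f_lt] /(_ isT) f_gt0; case: (sigma e); first by lra.
(* The map [x |-> r - x] exchanges the two intervals of a negative edge. *)
by case/orP=> /andP[? ?]; apply/orP; [right | left]; lra.
Qed.

Section Equivalences.

Variables (G : signed_graph) (p q : nat).
Hypotheses (q_gt0 : (0 < q)%N) (p_even : ~~ odd p) (le_2q_p : (2 * q <= p)%N).

Let p_gt1 : (1 < p)%N. Proof. by lia. Qed.
Let half_p : (p = p./2 * 2)%N. Proof. by lia. Qed.

(** On a negative edge, [x = 0] would be sent to [p], which lies outside the range. *)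
Lemma pq_value_opp s (x : int) :
  pq_value p q s x -> 0 < x -> pq_value p q s (p%:Z - x).
Proof. by case: s => /=; lia. Qed.

Lemma modulo_pq_flow_pq : admits_modulo_pq_flow p q G -> admits_pq_flow p q G.
Proof.
case=> D [h [h_val bdh]].
(* Representatives are viewed as rationals so that they can be divided by [p] and rounded. *)
pose f e : rat := (h e : nat)%:R.
have p_gt0Q : 0 < p%:R :> rat by rewrite ltr0n ltnW.
have [e | v | D' [b [b_gt0 bdb]]] := @exists_nonneg_flow _ _ _ D f p_gt0Q.
- by rewrite ler0n ltr_nat ltn_Zp.
- have [k bdk] := lift_Zp_boundary p_gt1 (bdh v).
  exists k; rewrite -[p%:R]/(p%:Z%:~R) -intrM -bdk -boundary_intr.
  exact: eq_boundary.
exists D', (fun e => if b e then p%:Z - (h e : nat)%:Z else (h e : nat)%:Z).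
split=> [e | v].
  case: ifP => [/b_gt0 | _]; last exact: h_val.
  by rewrite ltr0n => h_gt0; apply: pq_value_opp.
apply/eqP; rewrite -(intr_eq0 rat) -boundary_intr -[X in _ == X](bdb v).
by apply/eqP/eq_boundary => e /=; case: ifP => // _; rewrite rmorphB.
Qed.

Lemma pq_flow_modulo_pq : admits_pq_flow p q G -> admits_modulo_pq_flow p q G.
Proof.
case=> D [f [f_val bdf]].
exists D, (fun e => (f e)%:~R); split=> [e | v]; last first.
  by rewrite boundary_intr bdf.
have := f_val e; case fE: (f e) => [n|n]; last by case: (sigma e) => /=; lia.
rewrite val_Zp_int //; case: (sigma e) => /= ?; rewrite modn_small; lia.
Qed.

Variables (R : realType) (r : R).
Hypothesis r_def : r = p%:R / q%:R.

Let q_gt0R : 0 < q%:R :> R. Proof. by rewrite ltr0n. Qed.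
Let qr : q%:R * r = p%:R. Proof. by rewrite r_def mulrC divfK // lt0r_neq0. Qed.
Let half_pR : p%:R = p./2%:R * 2 :> R. Proof. by rewrite -natrM -half_p. Qed.

(** After scaling by [q], the endpoints of the allowed intervals become the integers [q], [p - q],
    [p/2 - q], [p/2 + q] and [p], so rounding preserves the weak inequalities. *)
Lemma circular_flow_modulo_pq :
  admits_circular_flow r G -> admits_modulo_pq_flow p q G.
Proof.
case=> D [f [f_itv f_val bdf]].
(* Reversing the edges of negative value turns [f] into a flow with values [|f e|]. *)
pose D1 := reversed D (fun e => f e < 0).
have bd1 v : boundary D1 (fun e => q%:R * `|f e|) v = 0.
  rewrite boundaryZ -[RHS](mulr0 q%:R) -(bdf v); congr (_ * _).
  rewrite -(boundary_reversed D (fun e => f e < 0)); apply: eq_boundary => e.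
  by case: ltP => [/ltW/ler0_norm | /ger0_norm].
have [v | g [g_itv bdg]] :=
    @exists_integral_rounding R G D1 (fun e => q%:R * `|f e|).
  by rewrite bd1 rpred0.
exists D1, (fun e => (g e)%:~R); split=> [e | v]; last first.
  rewrite boundary_intr; suff -> : boundary D1 g v = 0 by [].
  by apply/eqP; rewrite -(intr_eq0 R) bdg bd1.
have {g_itv}/andP[g_ge g_le] := g_itv e.
have ge_g (n : nat) : n%:R <= q%:R * `|f e| -> n%:Z <= g e.
  by move=> n_le; apply: le_trans g_ge; rewrite floor_ge_int.
have le_g (n : nat) : q%:R * `|f e| <= n%:R -> g e <= n%:Z.
  by move=> n_le; apply: le_trans g_le _; rewrite ceil_le_int.
have [n gE] : exists n : nat, g e = n.
  by have := ge_g 0%N; case: (g e) => n; [exists n | rewrite mulr_ge0 // => /(_ isT)].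
rewrite gE val_Zp_int //; rewrite {}gE in ge_g le_g.
have q_ge0 := ltW q_gt0R; have := qr; have := half_pR => pE qrE.
have := f_val e; case: (sigma e) => /=.
  case/andP=> /(ler_wpM2l q_ge0) f_ge /(ler_wpM2l q_ge0) f_le.
  have : q%:Z <= n by apply: ge_g; lra.
  have : n%:Z <= (p - q)%N by apply: le_g; rewrite natrB; [lra | lia].
  by move=> ? ?; rewrite modn_small; lia.
case/orP=> /andP[/(ler_wpM2l q_ge0) f_ge f_le].
  have {}f_le := ler_wpM2l q_ge0 f_le.
  have : n%:Z <= (p./2 - q)%N by apply: le_g; rewrite natrB; [lra | lia].
  by move=> ?; rewrite modn_small; lia.
have {}f_le := ler_wpM2l q_ge0 (ltW f_le).
have : (p./2 + q)%N%:Z <= n by apply: ge_g; rewrite natrD; lra.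
have : n%:Z <= p by apply: le_g; lra.
(* Rounding up may give the value [p], which is [0] in ['Z_p]. *)
rewrite lez_nat leq_eqVlt => /orP[/eqP -> | n_lt ?]; first by rewrite modnn; lia.
by rewrite modn_small; lia.
Qed.

Lemma modulo_pq_flow_circular_modulo :
  admits_modulo_pq_flow p q G -> admits_circular_modulo_flow r G.
Proof.
case=> D [h [h_val bdh]].
have rE : r = q%:R^-1 * p%:R by rewrite r_def mulrC.
have hlt e : (h e < p)%N by apply: ltn_Zp.
have qV0 : 0 < q%:R^-1 :> R by rewrite invr_gt0.
have qqV : q%:R^-1 * q%:R = 1 :> R by rewrite mulVf ?lt0r_neq0.
exists D, (fun e => q%:R^-1 * (h e : nat)%:R); split=> [e | e | v].
- by rewrite mulr_ge0 ?ler0n 1?ltW //= r_def mulrC ltr_pM2r // ltr_nat.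
(* Each integer bound is divided by [q]; a summand [q] becomes 1 by [qqV]. *)
- have scale (m n : nat) : (m <= n)%N -> q%:R^-1 * m%:R <= q%:R^-1 * n%:R :> R.
    by move=> le_mn; rewrite ler_wpM2l ?ler_nat // ltW.
  have r2E : r = q%:R^-1 * (p./2%:R * 2) by rewrite -half_pR.
  have h_ge0 := scale 0%N (h e) isT.
  have h_lt : q%:R^-1 * (h e)%:R < r by rewrite rE ltr_pM2l // ltr_nat.
  have := h_val e; case: (sigma e) => /=.
    move=> hv; have := scale q (h e); have := scale (h e + q)%N p.
    rewrite natrD => /(_ ltac:(lia)) ? /(_ ltac:(lia)) ?; lra.
  case/orP=> hv; apply/orP; [left | right].
    have := scale (h e + q)%N p./2; rewrite natrD => /(_ ltac:(lia)) ?; lra.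
  have := scale (p./2 + q)%N (h e); rewrite natrD => /(_ ltac:(lia)) ?; lra.
- have [k bdk] := lift_Zp_boundary p_gt1 (bdh v); exists k.
  rewrite boundaryZ rE mulrCA; congr (_ * _).
  by rewrite -[p%:R]/(p%:Z%:~R) -intrM -bdk -boundary_intr; apply: eq_boundary.
Qed.

End Equivalences.

Theorem theorem3p5 (R : realType) (G : signed_graph) (p q : nat) (r : R)
    (p_gt0 : (0 < p)%N) (q_gt0 : (0 < q)%N) (p_even : ~~ odd p)
    (le_2q_p : (2 * q <= p)%N) (r_def : r = p%:R / q%:R) :
  [<-> admits_circular_flow r G;
       admits_pq_flow p q G;
       admits_modulo_pq_flow p q G;
       admits_circular_modulo_flow r G].
Proof.
tfae.
(* Rounding only gives a modulo flow, from which the [(p,q)]-flow is then obtained. *)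
- move=> /(circular_flow_modulo_pq q_gt0 p_even le_2q_p r_def).
  exact: modulo_pq_flow_pq.
- exact: pq_flow_modulo_pq.
- exact: modulo_pq_flow_circular_modulo.
- by apply: circular_modulo_flow_circular; rewrite r_def divr_gt0 ?ltr0n.
Qed.
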